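(* For each $\gamma\in(0,1)$ and each essentially smooth transformation $\phi$, the response function $\rho_\gamma:(0,+\infty)\to(0,1)$ generated by $\phi$ has the following properties: (i) $\rho_\gamma(w)$ is strictly increasing in $w$. (ii) $\rho_\gamma(w)$ is continuous in $w$. (iii) $\rho_\gamma(w)\to\gamma$ as $w\to0$. (iv) $\rho_\gamma(w)\to1$ as $w\to+\infty$. Conversely, for every $\gamma\in(0,1)$, any function $(0,+\infty)\to(0,1)$ satisfying (i)--(iv) is the response function $\rho_\gamma$ generated by some essentially smooth transformation $\phi$.
   Context: A transformation is a convex, lower semicontinuous $\phi:\mathbb{R}_+\to[0,+\infty]$ with $\phi(1)=0$ which (standing assumption) is superlinear at infinity ($\phi(t)/t\to+\infty$ as $t\to+\infty$), strictly convex on $\operatorname{int}(\operatorname{dom}\phi)$, and satisfies $1\in\operatorname{int}(\operatorname{dom}\phi)$. It is essentially smooth if it is finite and differentiable on $(0,+\infty)$ and $\lim_{t\to0}\phi'(t)=-\infty$. Its conjugate is $\psi(t)=\phi^\star(t)=\sup_{u\ge0}tu-\phi(u)$, $t\in\mathbb{R}$ (finite and differentiable on $\mathbb{R}$). For $\gamma\in(0,1)$, the response function generated by $\phi$ is $\rho_\gamma(w)=\gamma\psi'(w-\ell_\gamma(w))$, $w>0$, where $\ell_\gamma(w)\in\mathbb{R}$ is the unique solution of $\gamma\psi'(w-\ell_\gamma(w))+(1-\gamma)\psi'(-\ell_\gamma(w))=1$. *)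

(* Defs.v *)
From mathcomp Require Import all_boot all_order all_algebra.
From mathcomp Require Import all_classical all_reals all_analysis.

Set Implicit Arguments.
Unset Strict Implicit.
Unset Printing Implicit Defensive.

Import Order.TTheory GRing.Theory Num.Theory.
Import numFieldNormedType.Exports.

Local Open Scope classical_set_scope.
Local Open Scope ring_scope.

(* A function defined on R_+ = [0, +oo[ (resp. on ]0, +oo[) is represented by a
   function on R whose values off that interval are unconstrained and are never
   used. *)

Definition effective_domain (R : realType) (phi : R -> \bar R) : set R :=
  [set u | 0 <= u /\ (phi u < +oo)%E].

Record transformation (R : realType) (phi : R -> \bar R) : Prop := {
  transformation_ge0 : forall u : R, 0 <= u -> (0 <= phi u)%E ;
  transformation_convex : forall x y t : R, 0 <= x -> 0 <= y -> 0 < t < 1 ->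
    (phi (t * x + (1 - t) * y)%R <= t%:E * phi x + (1 - t)%:E * phi y)%E ;
  (* [subspace A] carries the relative topology of A at the points of A, and is
     discrete elsewhere. *)
  transformation_lsc :
    lower_semicontinuous (phi : subspace `[0, +oo[ -> \bar R) ;
  transformation1 : phi 1 = 0%E ;
  transformation_superlinear : (phi t * (t^-1)%:E)%E @[t --> +oo] --> +oo%E ;
  transformation_strictly_convex : forall x y t : R,
    (effective_domain phi)° x -> (effective_domain phi)° y -> x != y ->
    0 < t < 1 ->
    (phi (t * x + (1 - t) * y)%R < t%:E * phi x + (1 - t)%:E * phi y)%E ;
  transformation_dom1 : (effective_domain phi)° 1 }.

Record essentially_smooth (R : realType) (phi : R -> \bar R) : Prop := {
  essentially_smooth_fin : forall t : R, 0 < t -> phi t \is a fin_num ;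
  essentially_smooth_derivable : forall t : R, 0 < t ->
    derivable (fine \o phi) t 1 ;
  essentially_smooth_cvg0 : derive1 (fine \o phi) t @[t --> 0^'+] --> -oo%R }.

Definition conjugate (R : realType) (phi : R -> \bar R) (t : R) : \bar R :=
  ereal_sup [set ((t * u)%:E - phi u)%E | u in `[0, +oo[].

Definition conjugate' (R : realType) (phi : R -> \bar R) : R -> R :=
  derive1 (fine \o conjugate phi).

Definition response_equation (R : realType) (gamma : R) (phi : R -> \bar R)
    (w : R) : set R :=
  [set l | gamma * conjugate' phi (w - l) + (1 - gamma) * conjugate' phi (- l)
           = 1].

(* The unique solution of the equation; the default value 0 is returned only
   when there is no unique solution, which does not happen for an essentially
   smooth transformation, 0 < gamma < 1 and 0 < w. *)
Definition ell (R : realType) (gamma : R) (phi : R -> \bar R) (w : R) : R :=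
  xget 0 [set l | unique (response_equation gamma phi w) l].

Definition response (R : realType) (gamma : R) (phi : R -> \bar R) (w : R) : R :=
  gamma * conjugate' phi (w - ell gamma phi w).

Record response_properties (R : realType) (gamma : R) (rho : R -> R) : Prop := {
  response_increasing : {in `]0, +oo[ &, {homo rho : x y / x < y}} ;
  response_continuous : {within `]0, +oo[, continuous rho} ;
  response_cvg0 : rho w @[w --> 0^'+] --> gamma ;
  response_cvgy : rho w @[w --> +oo] --> (1 : R) }.

(* Main.v *)
(* An essentially smooth transformation [phi] enters the response equation only
   through [h = psi'], the inverse of [phi'], which can be any increasing
   bijection from [R] onto ]0, +oo[ with [h 0 = 1]. The normalization makes both
   [w - ell w] and [ell w] increasing, so [ell] is 1-Lipschitz on [0, +oo[, which
   gives (i)-(iii); (iv) holds because [w - ell w] is bounded by [h^-1 (1 / gamma)].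
   Conversely one is free to choose [ell]. Taking [ell] to be the inverse of
   [y |-> y + y / (1 + y)] keeps [w - ell w] below 1, so that the response function
   prescribes [h] on ]-oo, 1[ only, with values below [1 / gamma], and [h] can be
   continued linearly to an increasing bijection; [phi] is then the conjugate of
   an antiderivative of [h]. *)
Require Import Defs.
From mathcomp Require Import all_boot all_order all_algebra.
From mathcomp Require Import all_classical all_reals all_analysis.
From mathcomp Require Import ring lra.

Set Implicit Arguments.
Unset Strict Implicit.
Unset Printing Implicit Defensive.

Import Order.TTheory GRing.Theory Num.Theory.
Import numFieldNormedType.Exports.

Local Open Scope classical_set_scope.
Local Open Scope ring_scope.

(** * Continuity and differentiability criteria *)

(** One point on each side of [x] with value within [e] of [f x] controls [f] on the whole interval
    between them by monotonicity. This gives continuity of inverses of increasing maps from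
    surjectivity alone. *)
Lemma monotone_dense_image_continuous (R : realType) (D : set R) (f : R -> R)
    (x : R) :
  nbhs x D ->
  (forall y z, D y -> D z -> y <= z -> f y <= f z) ->
  (forall e, 0 < e -> exists2 y : R, D y & y < x /\ f x - e < f y) ->
  (forall e, 0 < e -> exists2 y, D y & x < y /\ f y < f x + e) ->
  {for x, continuous f}.
Proof.
move=> xD homf lef gef; apply/cvgrPdist_lt => e e0 /=.
have [y Dy [yx fy]] := lef _ e0; have [z Dz [xz fz]] := gef _ e0.
near=> t.
have Dt : D t by near: t.
have yt : y <= t by apply/ltW; near: t; exact: lt_nbhsr.
have tz : t <= z by apply/ltW; near: t; exact: lt_nbhsl.
have := homf _ _ Dy Dt yt; have := homf _ _ Dt Dz tz.
move=> h1 h2; rewrite ltr_norml; apply/andP; split; lra.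
Unshelve. all: by end_near. Qed.

(** The difference quotient of [F] at [x] lies between [D x] and [D y], in an order depending on the
    side, so continuity of [D] makes it converge. It is applied with [D] a continuous choice of
    subgradients. *)
Lemma is_derive_sandwich (R : realType) (F D : R -> R) (x : R) :
  {for x, continuous D} ->
  (\forall y \near x,
     D x * (y - x) <= F y - F x /\ F y - F x <= D y * (y - x)) ->
  is_derive x 1 F (D x).
Proof.
move=> cD nF; apply/is_derive1_caratheodory.
exists (fun y => if y == x then D x else (F y - F x) / (y - x)); split.
- move=> z; case: eqP => [->|/eqP zx]; first by rewrite !subrr mulr0.
  by rewrite divfK// subr_eq0.
- apply/cvgrPdist_le => e e0 /=; rewrite eqxx.
  have {}cD := @cvgr_dist_le _ _ _ _ _ _ _ cD _ e0.
  near=> y.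
  have /= Dy : `|D x - D y| <= e by near: y; exact: cD.
  have [F1 F2] : D x * (y - x) <= F y - F x /\ F y - F x <= D y * (y - x).
    by near: y; exact: nF.
  case: eqP => [_|/eqP yx]; first by rewrite subrr normr0 ltW.
  set q := (F y - F x) / (y - x).
  have qE : F y - F x = q * (y - x) by rewrite /q divfK// subr_eq0.
  rewrite qE in F1 F2.
  move: Dy; rewrite !ler_norml => /andP[D1 D2].
  case: (ltgtP y x) yx => // yx _.
  + have h1 : q <= D x by nra.
    have h2 : D y <= q by nra.
    by apply/andP; split; lra.
  + have h1 : D x <= q by nra.
    have h2 : q <= D y by nra.
    by apply/andP; split; lra.
- by rewrite eqxx.
Unshelve. all: by end_near. Qed.

(** * Increasing bijections onto ]0, +oo[ and the derivative of a conjugate *)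

Record increasing_onto_pos (R : realType) (h : R -> R) : Prop := {
  iop_homo : {homo h : x y / x < y} ;
  iop_gt0 : forall t, 0 < h t ;
  iop_onto : forall u, 0 < u -> exists t, h t = u }.

Lemma iop_mono (R : realType) (h : R -> R) : increasing_onto_pos h ->
  {mono h : x y / x <= y}.
Proof. by move=> [hh _ _]; exact: le_mono. Qed.

Lemma iop_mono_lt (R : realType) (h : R -> R) : increasing_onto_pos h ->
  {mono h : x y / x < y}.
Proof. by move=> /iop_mono; exact: leW_mono. Qed.

Lemma iop_continuous (R : realType) (h : R -> R) : increasing_onto_pos h ->
  continuous h.
Proof.
move=> hP x; apply: (@monotone_dense_image_continuous R setT).
- exact: filterT.
- by move=> y z _ _; rewrite (iop_mono hP).
(* The maximum with [h x / 2] keeps the target value positive, hence in the range of [h]. *)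
- move=> e e0; have [t ht] : exists t, h t = Num.max (h x / 2) (h x - e / 2).
    by apply: (iop_onto hP); rewrite lt_max divr_gt0// (iop_gt0 hP).
  have hx := iop_gt0 hP x.
  exists t => //; rewrite -(iop_mono_lt hP) ht gt_max lt_max.
  by split; [apply/andP; split|apply/orP; right]; lra.
- move=> e e0; have hx := iop_gt0 hP x.
  have [|t ht] := @iop_onto _ _ hP (h x + e / 2); first lra.
  by exists t => //; rewrite -(iop_mono_lt hP) ht; split; lra.
Qed.

(** Since [t] is a subgradient of [phi] at [h t], the supremum defining the conjugate at [t] is
    attained at [h t]. Comparing two parameters [s] and [t] then sandwiches the increment of the
    conjugate between [h t * (s - t)] and [h s * (s - t)]. *)
Lemma conjugate_subgradient (R : realType) (phi : R -> \bar R) (h : R -> R) :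
  increasing_onto_pos h ->
  (forall t, phi (h t) \is a fin_num) ->
  (forall t u, 0 <= u -> (phi (h t) + (t * (u - h t))%:E <= phi u)%E) ->
  conjugate' phi =1 h.
Proof.
move=> hP fin sub.
have conjE t : conjugate phi t = (t * h t - fine (phi (h t)))%:E.
  rewrite /conjugate; apply/eqP; rewrite eq_le; apply/andP; split.
    apply: ge_ereal_sup => _ [u /= + <-]; rewrite in_itv/= andbT => u0.
    have := sub t u u0; rewrite -(fineK (fin t)).
    case: (phi u) => [r| |] //=; rewrite ?lee_fin; last by rewrite addeNy leNye.
    by move=> ?; lra.
  apply: ereal_sup_ubound; exists (h t).
    by rewrite /= in_itv/= andbT ltW// (iop_gt0 hP).
  by rewrite -{1}(fineK (fin t)).
move=> t; rewrite /conjugate' derive1E.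
suff /@derive_val -> : is_derive t 1 (fine \o conjugate phi) (h t) by [].
apply: is_derive_sandwich; first exact: iop_continuous.
near=> s; rewrite /= !conjE /=.
have hs := ltW (iop_gt0 hP s); have ht := ltW (iop_gt0 hP t).
have := sub t _ hs; have := sub s _ ht.
rewrite -(fineK (fin t)) -(fineK (fin s)) !lee_fin => h1 h2; split; lra.
Unshelve. all: by end_near. Qed.

(** * The response equation and properties (i)-(iv) *)

Lemma response_equation_decr (R : realType) (gamma w x y : R) (h : R -> R) :
  0 < gamma < 1 -> increasing_onto_pos h -> x < y ->
  gamma * h (w - y) + (1 - gamma) * h (- y) <
  gamma * h (w - x) + (1 - gamma) * h (- x).
Proof.
move=> /andP[g0 g1] hP xy.
have h1 : h (w - y) < h (w - x) by rewrite (iop_mono_lt hP); lra.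
have h2 : h (- y) < h (- x) by rewrite (iop_mono_lt hP); lra.
by nra.
Qed.

Lemma response_equation_ellP (R : realType) (gamma w l : R)
    (phi : R -> \bar R) (h : R -> R) :
  0 < gamma < 1 -> increasing_onto_pos h -> conjugate' phi =1 h ->
  gamma * h (w - l) + (1 - gamma) * h (- l) = 1 -> ell gamma phi w = l.
Proof.
move=> g01 hP phiE lE.
have uniq l' : response_equation gamma phi w l' -> l' = l.
  rewrite /response_equation /= !phiE => l'E.
  by have [/(response_equation_decr w g01 hP)|
           /(response_equation_decr w g01 hP)|] := ltgtP l' l => //; lra.
apply: xget_unique => [|l' [/uniq//]].
by split => [|l' /uniq//]; rewrite /response_equation /= !phiE.
Qed.

Lemma response_equation_sol (R : realType) (gamma w : R) (h : R -> R) :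
  0 < gamma < 1 -> increasing_onto_pos h -> 0 <= w ->
  exists l, gamma * h (w - l) + (1 - gamma) * h (- l) = 1.
Proof.
move=> /andP[g0 g1] hP w0; have [s hs] := iop_onto hP ltr01.
pose F l := gamma * h (w - l) + (1 - gamma) * h (- l).
have cF : continuous F.
  move=> x; apply: cvgD; apply: cvgM; try exact: cvg_cst.
    apply: (continuous_comp (f := fun l => w - l)); last exact: iop_continuous.
    by apply: cvgB; [exact: cvg_cst|exact: cvg_id].
  apply: (continuous_comp (f := fun l => - l)); last exact: iop_continuous.
  by apply: cvgN; exact: cvg_id.
(* With [h s = 1], at [l = - s] the second value of [h] is 1 and the first at least 1; at
   [l = w - s] the first is 1 and the second at most 1. So [F] passes through 1 in between. *)
have [|||l _ lE] := @IVT _ F (- s) (w - s) 1; first lra.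
- exact: continuous_subspaceT.
- have h1 : h s <= h (w + s) by rewrite (iop_mono hP); lra.
  have h2 : h (- (w - s)) <= h s by rewrite (iop_mono hP); lra.
  rewrite ge_min le_max /F opprK (_ : w - (w - s) = s); last by ring.
  rewrite hs in h1 h2 *.
  have p1 : 0 <= gamma * (h (w + s) - 1) by rewrite mulr_ge0; lra.
  have p2 : 0 <= (1 - gamma) * (1 - h (- (w - s))) by rewrite mulr_ge0; lra.
  by apply/andP; split; apply/orP; [right|left]; lra.
- by exists l.
Qed.

Lemma response_properties_sol (R : realType) (gamma : R) (h l r : R -> R) :
  0 < gamma < 1 -> increasing_onto_pos h ->
  (forall w : R, 0 <= w -> gamma * h (w - l w) + (1 - gamma) * h (- l w) = 1) ->
  (forall w : R, r w = gamma * h (w - l w)) ->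
  (forall w : R, 0 < w -> 0 < r w < 1) /\ response_properties gamma r.
Proof.
move=> /andP[g0 g1] hP lP rE; have g1' : 0 < 1 - gamma by rewrite subr_gt0.
have rE' (w : R) : 0 <= w -> r w = 1 - (1 - gamma) * h (- l w).
  by move=> /lP lw; rewrite rE; lra.
(* If [l] or [w - l w] failed to increase, both terms of the equation would move in the same
   direction from [w] to [w'], one of them strictly, although the sum stays 1. *)
have lincr (w w' : R) : 0 <= w -> w < w' -> l w < l w' /\ w - l w < w' - l w'.
  move=> w0 ww'; have w'0 : 0 <= w' by lra.
  have := lP _ w0; have := lP _ w'0 => e e'.
  have lt1 : l w < l w'.
    rewrite ltNge; apply/negP => ll.
    have h1 : h (w - l w) < h (w' - l w') by rewrite (iop_mono_lt hP); lra.
    have h2 : h (- l w) <= h (- l w') by rewrite (iop_mono hP); lra.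
    by rewrite -(ltr_pM2l g0) in h1; rewrite -(ler_pM2l g1') in h2; lra.
  split => //; rewrite ltNge; apply/negP => ll.
  have h1 : h (w' - l w') <= h (w - l w) by rewrite (iop_mono hP); lra.
  have h2 : h (- l w') < h (- l w) by rewrite (iop_mono_lt hP); lra.
  by rewrite -(ler_pM2l g0) in h1; rewrite -(ltr_pM2l g1') in h2; lra.
have llip (w w' : R) : 0 <= w -> 0 <= w' -> `|l w - l w'| <= `|w - w'|.
  move=> w0 w'0; have [ww'|ww'|->] := ltgtP w w'; last by rewrite !subrr.
    have [h1 h2] := lincr _ _ w0 ww'.
    by rewrite !ltr0_norm; lra.
  have [h1 h2] := lincr _ _ w'0 ww'.
  by rewrite !gtr0_norm; lra.
(* A general filter serves both continuity at [w > 0] and the right limit at 0. *)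
have rcvg (F : set_system R) (w : R) : Filter F -> 0 <= w -> F --> w ->
    (\forall x \near F, 0 <= x) -> r x @[x --> F] -->
      r w.
  move=> FF w0 Fw F0.
  have lF : l x @[x --> F] --> l w.
    apply/cvgrPdist_lt => e e0; near=> x.
    apply: le_lt_trans (llip _ _ w0 _) _; first by near: x.
    by near: x; exact: (@cvgr_dist_lt _ _ _ _ _ id).
  have : 1 - (1 - gamma) * h (- l x) @[x --> F] -->
      1 - (1 - gamma) * h (- l w).
    apply: cvgB; first exact: cvg_cst.
    apply: cvgM; first exact: cvg_cst.
    by apply: continuous_cvg; [exact: iop_continuous|exact: cvgN].
  rewrite -rE'//; apply: cvg_trans; apply: near_eq_cvg.
  by near=> x; rewrite rE'//; near: x.
have r0 : r 0 = gamma.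
  rewrite rE sub0r; have := lP 0 (lexx _); rewrite sub0r => e.
  by rewrite (_ : h _ = 1) ?mulr1//; lra.
split; first move=> w w0.
  rewrite {1}rE mulr_gt0 ?(iop_gt0 hP)//= rE' ?ltW//.
  by have := mulr_gt0 g1' (iop_gt0 hP (- l w)); lra.
split.
- move=> x y; rewrite !in_itv/= !andbT => x0 y0 xy.
  have [_ h1] := lincr _ _ (ltW x0) xy.
  by rewrite !rE ltr_pM2l// (iop_mono_lt hP).
- rewrite continuous_open_subspace; last exact: interval_open.
  move=> w /set_mem /=; rewrite in_itv/= andbT => w0.
  apply: rcvg; [exact: ltW|exact: cvg_id|].
  by near=> x; apply/ltW; near: x; exact: lt_nbhsr.
- rewrite -[X in _ --> X]r0; apply: rcvg => //.
    by apply: cvg_at_right_filter; exact: cvg_id.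
  by near=> x; apply/ltW; near: x; exact: nbhs_right_gt.
(* As [gamma * h (w - l w) < 1], [w - l w] stays below [s], so [- l w <= s - w]. Once [w] exceeds
   [s - t] with [h t = e], the gap [1 - r w = (1 - gamma) * h (- l w)] is at most [e]. *)
- have [s hs] : exists s, h s = gamma^-1.
    by apply: (iop_onto hP); rewrite invr_gt0.
  apply/cvgrPdist_le => e e0.
  have [t ht] : exists t, h t = e by apply: (iop_onto hP).
  near=> w.
  have w0 : 0 <= w by apply/ltW; near: w; apply: nbhs_pinfty_gt; exact: num_real.
  have hl := iop_gt0 hP (- l w).
  have : h (w - l w) <= h s.
    rewrite hs -(ler_pM2l g0) divff ?gt_eqF//.
    by have := lP _ w0; have := mulr_gt0 g1' hl; lra.
  rewrite (iop_mono hP) => ws.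
  have : h (- l w) <= h t.
    rewrite (iop_mono hP).
    suff : s - t <= w by move=> ?; lra.
    by apply/ltW; near: w; apply: nbhs_pinfty_gt; exact: num_real.
  rewrite rE'// ht => hle; rewrite subKr.
  rewrite gtr0_norm ?mulr_gt0//; apply: le_trans hle.
  by rewrite ler_piMl//; lra.
Unshelve. all: by end_near. Qed.

Lemma response_of_inverse (R : realType) (gamma : R) (phi : R -> \bar R)
    (h : R -> R) :
  0 < gamma < 1 -> increasing_onto_pos h -> conjugate' phi =1 h ->
  (forall w : R, 0 < w -> 0 < response gamma phi w < 1) /\
  response_properties gamma (response gamma phi).
Proof.
move=> g01 hP phiE.
apply: (@response_properties_sol _ _ h (ell gamma phi)) => // w.
- move=> w0; have [x xE] := response_equation_sol g01 hP w0.
  by rewrite (response_equation_ellP g01 hP phiE xE).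
- by rewrite /response phiE.
Qed.

(** * The derivative of an essentially smooth transformation *)

Lemma effective_domain_interior (R : realType) (phi : R -> \bar R) (x : R) :
  (forall t : R, 0 < t -> phi t \is a fin_num) -> 0 < x ->
  (effective_domain phi)° x.
Proof.
move=> fin x0; rewrite /interior /=; near=> y.
have y0 : 0 < y by near: y; exact: lt_nbhsr.
by split; [exact: ltW|rewrite -(fineK (fin _ y0)) ltry].
Unshelve. all: by end_near. Qed.

(** Divide by [t] and let [t] tend to 0 from the right. Carathéodory's slope function [G] avoids
    dividing by [v], which may have either sign or vanish. *)
Lemma derive1_le_secant (R : realType) (f : R -> R) (x v d : R) :
  derivable f x 1 ->
  (forall t : R, 0 < t < 1 -> f (x + t * v) - f x <= t * d) ->
  derive1 f x * v <= d.
Proof.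
move=> df fd.
have /is_derive1_caratheodory[G [GE cG <-]] : is_derive x 1 f (derive1 f x).
  by rewrite derive1E; exact: DeriveDef.
have Gcvg : G (x + t * v) * v @[t --> 0^'+] --> G x * v.
  apply: cvgM; last exact: cvg_cst.
  apply: continuous_cvg; first exact: cG.
  rewrite -[X in _ --> X]addr0 -[X in _ + X](mul0r v).
  apply: cvgD; [exact: cvg_cst|apply: cvgM; [|exact: cvg_cst]].
  by apply: cvg_at_right_filter; exact: cvg_id.
apply: (cvgr_to_le Gcvg); near=> t.
have t0 : 0 < t by near: t; exact: nbhs_right_gt.
have t1 : t < 1 by near: t; apply: nbhs_right_lt.
have t01 : 0 < t < 1 by rewrite t0 t1.
have := fd _ t01; rewrite GE (_ : x + t * v - x = t * v); last by ring.
by rewrite mulrCA ler_pM2l.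
Unshelve. all: by end_near. Qed.

(** Convexity on the segment from [x] to [u] bounds the increments of [phi] by [t] times the chord,
    as [derive1_le_secant] requires. The endpoint [u = 0] is included; there [phi] may be infinite,
    which is the trivial case. *)
Lemma support_line (R : realType) (phi : R -> \bar R) (x u : R) :
  transformation phi -> essentially_smooth phi -> 0 < x -> 0 <= u ->
  (phi x + (derive1 (fine \o phi) x * (u - x))%:E <= phi u)%E.
Proof.
move=> [ge0 cvx _ _ _ _ _] [fin der _] x0 u0.
have := ge0 u u0; case phiu : (phi u) => [r| |] // _; last by rewrite leey.
rewrite -(fineK (fin x x0)) -EFinD lee_fin.
rewrite addrC -lerBrDr; apply: derive1_le_secant; first exact: der.
move=> t /[dup] t01 /andP[t0 t1].
have := cvx u x t u0 (ltW x0) t01.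
have -> : t * u + (1 - t) * x = x + t * (u - x) by ring.
have y0 : 0 < x + t * (u - x).
  have -> : x + t * (u - x) = t * u + (1 - t) * x by ring.
  have : 0 <= t * u by rewrite mulr_ge0// ltW.
  have : 0 < (1 - t) * x by rewrite mulr_gt0// subr_gt0.
  by lra.
rewrite phiu /= -(fineK (fin _ x0)) -(fineK (fin _ y0)) /= -EFinM -EFinM -EFinD.
rewrite lee_fin => le; lra.
Qed.

(** The support line at [x] bounds [phi] at the midpoint from below, while strict convexity puts
    [phi] there strictly under the chord. *)
Lemma strict_support_line (R : realType) (phi : R -> \bar R) (x u : R) :
  transformation phi -> essentially_smooth phi -> 0 < x -> 0 < u -> x != u ->
  fine (phi x) + derive1 (fine \o phi) x * (u - x) < fine (phi u).
Proof.
move=> tphi sphi x0 u0 xu; have fin := essentially_smooth_fin sphi.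
have h01 : 0 < (2^-1 : R) < 1 by lra.
have m0 : 0 < 2^-1 * x + (1 - 2^-1) * u by lra.
have := transformation_strictly_convex tphi (effective_domain_interior fin x0)
  (effective_domain_interior fin u0) xu h01.
have := support_line tphi sphi x0 (ltW m0).
rewrite -(fineK (fin _ x0)) -(fineK (fin _ u0)) -(fineK (fin _ m0)).
rewrite -EFinD -!EFinM -EFinD lee_fin lte_fin /=.
by set a := fine _; set b := fine _; set c := fine _; lra.
Qed.

Lemma derive1_increasing (R : realType) (phi : R -> \bar R) (x y : R) :
  transformation phi -> essentially_smooth phi -> 0 < x -> x < y ->
  derive1 (fine \o phi) x < derive1 (fine \o phi) y.
Proof.
move=> tphi sphi x0 xy; have y0 := lt_trans x0 xy.
have := strict_support_line tphi sphi x0 y0 (negbT (lt_eqF xy)).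
have := strict_support_line tphi sphi y0 x0 (negbT (gt_eqF xy)).
set a := fine _; set b := fine _; set c := derive1 _ _; set d := derive1 _ _.
move=> h1 h2; rewrite -subr_gt0 -(pmulr_rgt0 _ (_ : 0 < y - x)) ?subr_gt0//.
by lra.
Qed.

(** The support line at [b], evaluated at 1 where [phi] vanishes, gives [phi b < phi' b * (b - 1)],
    and superlinearity makes [phi b] at least [(|t| + 1) * b]. *)
Lemma derive1_unbounded (R : realType) (phi : R -> \bar R) (t : R) :
  transformation phi -> essentially_smooth phi ->
  exists2 b, 1 < b & t < derive1 (fine \o phi) b.
Proof.
move=> tphi sphi.
have /cvgeyPge/(_ (`|t| + 1)) slin := transformation_superlinear tphi.
suff [b [b1 bt]] : exists b, 1 < b /\ ((`|t| + 1)%:E <= phi b * (b^-1)%:E)%E.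
  exists b => //; have b0 := lt_trans ltr01 b1.
  have := strict_support_line tphi sphi b0 ltr01 (negbT (gt_eqF b1)).
  rewrite (transformation1 tphi) /=.
  move: bt; rewrite -(fineK (essentially_smooth_fin sphi b0)) -EFinM lee_fin.
  rewrite ler_pdivlMr//; set a := fine _; set c := derive1 _ _ => h1 /= h2.
  apply: le_lt_trans (ler_norm t) _.
  rewrite -(ltr_pM2r (_ : 0 < b - 1)) ?subr_gt0//.
  by have := normr_ge0 t; lra.
near +oo_R => b; exists b; split; last by near: b.
by near: b; apply: nbhs_pinfty_gt; exact: num_real.
Unshelve. all: by end_near. Qed.

(** A Darboux argument, which does not presuppose continuity of the derivative: [phi u - t * u] has
    an interior minimum on a segment around points [a] and [b] with [phi' a < t < phi' b]. *)
Lemma derive1_onto (R : realType) (phi : R -> \bar R) (t : R) :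
  transformation phi -> essentially_smooth phi ->
  exists2 u, 0 < u & derive1 (fine \o phi) u = t.
Proof.
move=> tphi sphi.
have [a a01 at_] : exists2 a, 0 < a < 1 & derive1 (fine \o phi) a < t.
  have /cvgrNyPlt/(_ t) g0 := essentially_smooth_cvg0 sphi.
  near (0 : R)^'+ => a; exists a; last by near: a.
  apply/andP; split; near: a; [exact: nbhs_right_gt|exact: nbhs_right_lt].
have [b b1 bt] := derive1_unbounded t tphi sphi.
pose F u := fine (phi u) - t * u.
have dF (u : R) : 0 < u -> is_derive u 1 F (derive1 (fine \o phi) u - t).
  move=> u0; apply: is_deriveB.
    by rewrite derive1E; apply: DeriveDef => //; exact: essentially_smooth_derivable.
  change (is_derive u 1 (t *: (id : R -> R)) t).
  by apply: is_derive_eq; rewrite /GRing.scale /= mulr1.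
have sF (x u : R) : 0 < x -> 0 < u -> x != u ->
    F x + (derive1 (fine \o phi) x - t) * (u - x) < F u.
  move=> x0 u0 xu; have := strict_support_line tphi sphi x0 u0 xu.
  by rewrite /F; set p := fine _; set q := fine _; set r := derive1 _ _; lra.
(* The segment reaches slightly beyond [a] and [b], so that the strict support lines at these points
   exclude a minimum at either end. *)
have [||c cab cmin] := @EVT_min R F (a / 2) (b + 1); first lra.
  apply: derivable_within_continuous => x; rewrite in_itv/= => xab.
  by have [] : is_derive x 1 F (derive1 (fine \o phi) x - t) by apply: dF; lra.
move: cab; rewrite in_itv/= => /andP[ac cb0].
have [a0 b0] : 0 < a /\ 0 < b by lra.
have ca : c != a / 2.
  apply/eqP => ca; have a2 : 0 < a / 2 by lra.
  have aa2 : a != a / 2 by rewrite gt_eqF; lra.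
  have := sF _ _ a0 a2 aa2; have : F c <= F a by apply: cmin; rewrite in_itv/=; lra.
  have : 0 < (t - derive1 (fine \o phi) a) * (a / 2) by rewrite mulr_gt0// subr_gt0.
  by rewrite ca; set p := F _; set q := F _; set r := derive1 _ _; lra.
have cb : c != b + 1.
  apply/eqP => cb'; have b2 : 0 < b + 1 by lra.
  have bb2 : b != b + 1 by rewrite lt_eqF; lra.
  have := sF _ _ b0 b2 bb2; have : F c <= F b by apply: cmin; rewrite in_itv/=; lra.
  by rewrite cb'; set p := F _; set q := F _; set r := derive1 _ _ in bt *; lra.
have cab : c \in `]a / 2, b + 1[.
  by rewrite in_itv/= !lt_neqAle ac cb0 cb eq_sym ca.
exists c; first lra.
have d0 : is_derive c 1 F 0.
  apply: (derive1_at_min _ _ cab) => [|x|x] ; rewrite ?in_itv/=; first lra.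
    by move=> xab; have [] : is_derive x 1 F (derive1 (fine \o phi) x - t) by apply: dF; lra.
  by move=> /andP[ax xb]; apply: cmin; rewrite in_itv/= !ltW.
have c0 : 0 < c by lra.
apply/eqP; rewrite -subr_eq0; apply/eqP.
by rewrite -(@derive_val _ _ _ _ _ _ _ (dF c c0)) (@derive_val _ _ _ _ _ _ _ d0).
Unshelve. all: by end_near. Qed.

(** Here [h] is the inverse of [phi']: the support line at [h t] has slope [t], which is the
    hypothesis of [conjugate_subgradient]. *)
Lemma conjugate'_essentially_smooth (R : realType) (phi : R -> \bar R) :
  transformation phi -> essentially_smooth phi ->
  exists2 h, increasing_onto_pos h & conjugate' phi =1 h.
Proof.
move=> tphi sphi; set g := derive1 (fine \o phi).
have /choice[h hP] : forall t, exists u, 0 < u /\ g u = t.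
  by move=> t; have [u u0 gu] := derive1_onto t tphi sphi; exists u.
have h0 t : 0 < h t by have [] := hP t.
have gh t : g (h t) = t by have [] := hP t.
have iop : increasing_onto_pos h.
  split => // [x y xy|u u0].
  - have [//|yx|e] := ltgtP (h x) (h y).
      have := derive1_increasing tphi sphi (h0 y) yx; rewrite -/g !gh => ?.
      by lra.
    by have := gh x; rewrite e gh => yx; rewrite yx ltxx in xy.
  - exists (g u).
    have [lt|lt|//] := ltgtP (h (g u)) u.
      by have := derive1_increasing tphi sphi (h0 _) lt; rewrite -/g gh ltxx.
    by have := derive1_increasing tphi sphi u0 lt; rewrite -/g gh ltxx.
exists h => //; apply: conjugate_subgradient => // [t|t u u0].
  exact: essentially_smooth_fin.
by have := support_line tphi sphi (h0 t) u0; rewrite -/g gh.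
Qed.

(** * Antiderivatives and the Legendre transform *)

(** The integral of a nondecreasing [h] over [a, b] lies between [h a * (b - a)] and
    [h b * (b - a)]; these bounds are the subgradient inequality for [s] to the right and to the
    left of [t]. *)
Lemma monotone_antiderivative (R : realType) (h : R -> R) :
  continuous h -> {homo h : x y / x <= y} ->
  exists2 Psi : R -> R, Psi 0 = 0 &
    forall t s, Psi t + h t * (s - t) <= Psi s.
Proof.
move=> ch hh; pose I a b := \int[lebesgue_measure]_(x in `[a, b]) h x.
have int (a b : R) : lebesgue_measure.-integrable `[a, b] (EFin \o h).
  apply: continuous_compact_integrable; first exact: segment_compact.
  exact: continuous_subspaceT.
have intc (a b k : R) : lebesgue_measure.-integrable `[a, b] (EFin \o cst k).
  apply: continuous_compact_integrable; first exact: segment_compact.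
  by apply: continuous_subspaceT => x; exact: cvg_cst.
have Ic (a b k : R) : a <= b ->
    \int[lebesgue_measure]_(x in `[a, b]) cst k x = k * (b - a).
  move=> ab; rewrite Rintegral_cst//=; congr (_ * _).
  rewrite lebesgue_measure_itv/= lte_fin; case: ltP => //= ba.
  by rewrite (@le_anti _ _ a b) ?subrr// ab ba.
have Ige (a b : R) : a <= b -> h a * (b - a) <= I a b.
  move=> ab; rewrite -Ic//; apply: le_Rintegral => //.
  by move=> x; rewrite /= in_itv/= => /andP[ax _]; exact: hh.
have Ile (a b : R) : a <= b -> I a b <= h b * (b - a).
  move=> ab; rewrite -Ic//; apply: le_Rintegral => //.
  by move=> x; rewrite /= in_itv/= => /andP[_ xb]; exact: hh.
have ID (a b c : R) : a <= b -> b <= c -> I a c = I a b + I b c.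
  move=> ab bc; have := @Rintegral_itvB R h (BLeft a) (BRight c) b (int a c).
  rewrite !bnd_simp => /(_ ab bc); rewrite Rintegral_itv_obnd_cbnd.
    by rewrite -!/(I _ _) => <-; rewrite addrC subrK.
  apply: integrableS (int b c) => //.
  by apply: subset_itvr; rewrite bnd_simp.
have Iaa (a : R) : I a a = 0 by rewrite /I set_itv1 Rintegral_set1.
pose Psi t := if 0 <= t then I 0 t else - I t 0.
have PsiB (a b : R) : a <= b -> Psi b - Psi a = I a b.
  move=> ab; rewrite /Psi; have [b0|b0] := leP 0 b; have [a0|a0] := leP 0 a.
  - by rewrite (ID 0 a b)//; ring.
  - by rewrite (ID a 0 b) ?(ltW a0)//; ring.
  - by have := le_lt_trans ab b0; rewrite ltNge a0.
  - by rewrite (ID a b 0) ?(ltW b0)//; ring.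
exists Psi; first by rewrite /Psi lexx Iaa.
move=> t s; have [ts|/ltW st] := leP t s.
  by have := PsiB _ _ ts; have := Ige _ _ ts; lra.
by have := PsiB _ _ st; have := Ile _ _ st; lra.
Qed.

(** The convex conjugate with supremum over the whole line, whereas [conjugate] uses [0, +oo[ only;
    it recovers [phi] from its conjugate [Psi]. *)
Definition legendre (R : realType) (Psi : R -> R) (u : R) : \bar R :=
  ereal_sup (range (fun t => (t * u - Psi t)%:E)).

Lemma legendre_ge (R : realType) (Psi : R -> R) (t u : R) :
  ((t * u - Psi t)%:E <= legendre Psi u)%E.
Proof. by apply: ereal_sup_ubound; exists t. Qed.

Lemma legendreE (R : realType) (Psi h : R -> R) (t : R) :
  (forall t s, Psi t + h t * (s - t) <= Psi s) ->
  legendre Psi (h t) = (t * h t - Psi t)%:E.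
Proof.
move=> sub; apply/eqP; rewrite eq_le legendre_ge andbT.
apply: ge_ereal_sup => _ [s _ <-]; rewrite lee_fin.
by have := sub t s; lra.
Qed.

Lemma legendre_subgradient (R : realType) (Psi h : R -> R) (t u : R) :
  (forall t s, Psi t + h t * (s - t) <= Psi s) ->
  (legendre Psi (h t) + (t * (u - h t))%:E <= legendre Psi u)%E.
Proof.
move=> sub; rewrite (legendreE _ sub) -EFinD.
apply: le_trans (legendre_ge Psi t u); rewrite lee_fin.
by lra.
Qed.

(** Chaining the subgradient inequalities from [t] to the midpoint [m] and from [m] to [s] gains
    [(h m - h t) * (s - m)], which is positive. *)
Lemma legendre_strict (R : realType) (Psi h : R -> R) (s t : R) :
  {homo h : x y / x < y} ->
  (forall t s, Psi t + h t * (s - t) <= Psi s) -> s != t ->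
  Psi t + h t * (s - t) < Psi s.
Proof.
move=> hh sub st; pose m := (s + t) / 2.
have h1 := sub t m; have h2 := sub m s.
have : 0 < (h m - h t) * (s - m).
  have [lt|lt|e] := ltgtP s t; last by rewrite e eqxx in st.
    have /hh mt : m < t by rewrite /m; lra.
    have ms : s < m by rewrite /m; lra.
    by rewrite nmulr_rgt0; lra.
  have /hh mt : t < m by rewrite /m; lra.
  have ms : m < s by rewrite /m; lra.
  by rewrite pmulr_rgt0; lra.
have -> : s = m + m - t by rewrite /m; lra.
by rewrite (_ : s = m + m - t) in h2; [lra|rewrite /m; lra].
Qed.

Lemma legendre_convex (R : realType) (Psi : R -> R) (x y t : R) :
  0 < t < 1 ->
  (legendre Psi (t * x + (1 - t) * y)%R <=
   t%:E * legendre Psi x + (1 - t)%:E * legendre Psi y)%E.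
Proof.
move=> /andP[t0 t1]; apply: ge_ereal_sup => _ [s _ <-].
have -> : (s * (t * x + (1 - t) * y) - Psi s)%:E =
    (t%:E * (s * x - Psi s)%:E + (1 - t)%:E * (s * y - Psi s)%:E)%E.
  by rewrite -!EFinM -EFinD; congr EFin; ring.
by apply: leeD; apply: lee_wpmul2l; rewrite ?lee_fin ?legendre_ge//; lra.
Qed.

Lemma legendre_lsc (R : realType) (Psi : R -> R) (A : set R) :
  lower_semicontinuous (legendre Psi : subspace A -> \bar R).
Proof.
move=> x a /ereal_sup_gt[_ [t _ <-]]; rewrite lte_fin => atx.
exists [set y : R | a < t * y - Psi t]; last first.
  move=> y /= ay; apply: lt_le_trans (legendre_ge Psi t y).
  by rewrite lte_fin.
apply: open_nbhs_nbhs; split => //; apply: open_subspaceW.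
apply: (@open_comp _ _ (fun y : R => t * y - Psi t) [set z | a < z]).
  move=> y _; apply: cvgB; last exact: cvg_cst.
  by apply: cvgM; [exact: cvg_cst|exact: cvg_id].
exact: open_gt.
Qed.

(** The affine minorant of slope [A + 1] already suffices: its quotient by [t] exceeds [A] once [t]
    exceeds [Psi (A + 1)]. *)
Lemma legendre_superlinear (R : realType) (Psi : R -> R) :
  (legendre Psi t * (t^-1)%:E)%E @[t --> +oo] --> +oo%E.
Proof.
apply/cvgeyPge => A; near=> t.
have t0 : 0 < t by near: t; apply: nbhs_pinfty_gt; exact: num_real.
have tP : Psi (A + 1) < t by near: t; apply: nbhs_pinfty_gt; exact: num_real.
apply: (@le_trans _ _ (((A + 1) * t - Psi (A + 1))%:E * (t^-1)%:E)%E).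
  rewrite -EFinM lee_fin ler_pdivlMr//; lra.
by apply: lee_wpmul2r; [rewrite lee_fin invr_ge0 ltW|exact: legendre_ge].
Unshelve. all: by end_near. Qed.

Lemma legendre_fin (R : realType) (Psi h : R -> R) (u : R) :
  increasing_onto_pos h -> (forall t s, Psi t + h t * (s - t) <= Psi s) ->
  0 < u -> legendre Psi u \is a fin_num.
Proof.
by move=> hP sub u0; have [t <-] := iop_onto hP u0; rewrite (legendreE _ sub).
Qed.

(** The parameter [c] attaining the supremum at the intermediate point is a competitor at [x] and
    [y]. It is strictly suboptimal at [x], since [c = a] would force [x = y]. *)
Lemma legendre_strictly_convex (R : realType) (Psi h : R -> R) (x y t : R) :
  increasing_onto_pos h -> (forall t s, Psi t + h t * (s - t) <= Psi s) ->
  0 < x -> 0 < y -> x != y -> 0 < t < 1 ->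
  (legendre Psi (t * x + (1 - t) * y)%R <
   t%:E * legendre Psi x + (1 - t)%:E * legendre Psi y)%E.
Proof.
move=> hP sub x0 y0 xy /andP[t0 t1].
have s0 : 0 < 1 - t by rewrite subr_gt0.
have z0 : 0 < t * x + (1 - t) * y by rewrite addr_gt0// mulr_gt0.
have [a ax] := iop_onto hP x0; have [b bY] := iop_onto hP y0.
have [c cz] := iop_onto hP z0.
rewrite -cz -ax -bY !(legendreE _ sub) -!EFinM -EFinD lte_fin cz ax bY.
have ca : c != a.
  apply: contra xy => /eqP e; rewrite -subr_eq0.
  have : (1 - t) * (x - y) = 0 by move: cz; rewrite e ax; lra.
  by move/eqP; rewrite mulf_eq0 gt_eqF.
have h1 := legendre_strict (iop_homo hP) sub ca.
have h2 := sub b c; rewrite ax bY in h1 h2.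
by rewrite -(ltr_pM2l t0) in h1; rewrite -(ler_pM2l s0) in h2; lra.
Qed.

Lemma transformation_legendre (R : realType) (Psi h : R -> R) :
  increasing_onto_pos h -> (forall t s, Psi t + h t * (s - t) <= Psi s) ->
  Psi 0 = 0 -> h 0 = 1 -> transformation (legendre Psi).
Proof.
move=> hP sub Psi0 h0; have fin u := @legendre_fin _ _ _ u hP sub.
(* The effective domain lies in [0, +oo[, so an interior point at or below 0 would have negative
   points of the domain on its left. *)
have dom x : (effective_domain (legendre Psi))° x -> 0 < x.
  move=> dx; rewrite ltNge; apply/negP => x0.
  have : \forall y \near x^'-, effective_domain (legendre Psi) y.
    exact: cvg_within dx.
  move=> nx; near x^'- => y.
  have [y0 _] : effective_domain (legendre Psi) y by near: y.
  have : y < x by near: y; exact: nbhs_left_lt.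
  by lra.
split.
- move=> u _; apply: le_trans (legendre_ge Psi 0 u).
  by rewrite mul0r Psi0 subrr.
- by move=> x y t _ _; exact: legendre_convex.
- exact: legendre_lsc.
- by rewrite -h0 (legendreE _ sub) Psi0 mul0r subrr.
- exact: legendre_superlinear.
- by move=> x y t /dom x0 /dom y0; exact: (legendre_strictly_convex hP sub).
- exact: effective_domain_interior.
Unshelve. all: by end_near. Qed.

(** The derivative is [g], the inverse of [h]: the subgradient inequalities sandwich the increments,
    and [g y <= A] as soon as [y <= h A]. *)
Lemma essentially_smooth_legendre (R : realType) (Psi h : R -> R) :
  increasing_onto_pos h -> (forall t s, Psi t + h t * (s - t) <= Psi s) ->
  essentially_smooth (legendre Psi).
Proof.
move=> hP sub; have fin u := @legendre_fin _ _ _ u hP sub.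
have /choice[g gP] : forall u, exists t, 0 < u -> h t = u.
  move=> u; have [u0|u0] := ltP 0 u; last by exists 0.
  by have [t <-] := iop_onto hP u0; exists t.
have gh t : g (h t) = t.
  by apply: (inc_inj (iop_mono hP)); rewrite gP// (iop_gt0 hP).
have gle u v : 0 < u -> 0 < v -> (g u <= g v) = (u <= v).
  by move=> u0 v0; rewrite -(iop_mono hP) !gP.
have gc (u : R) : 0 < u -> {for u, continuous g}.
  move=> u0; apply: (@monotone_dense_image_continuous R [set y | 0 < y]).
  - exact: lt_nbhsr.
  - by move=> y z /= y0 z0; rewrite gle.
  - move=> e e0; exists (h (g u - e / 2)); first exact: iop_gt0.
    rewrite gh; split; last lra.
    by rewrite -{2}(gP _ u0) (iop_mono_lt hP); lra.
  - move=> e e0; exists (h (g u + e / 2)); first exact: iop_gt0.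
    rewrite gh; split; last lra.
    by rewrite -{1}(gP _ u0) (iop_mono_lt hP); lra.
have der (u : R) : 0 < u -> is_derive u 1 (fine \o legendre Psi) (g u).
  move=> u0; apply: is_derive_sandwich; first exact: gc.
  near=> y; have y0 : 0 < y by near: y; exact: lt_nbhsr.
  rewrite /= -(gP _ u0) -(gP _ y0) !(legendreE _ sub) /= !gh.
  have h1 := sub (g y) (g u); have h2 := sub (g u) (g y).
  by split; lra.
split => //; first by move=> t /der[].
apply/cvgrNyPle => A; near=> y.
have y0 : 0 < y by near: y; exact: nbhs_right_gt.
have yA : y <= h A.
  by apply/ltW; near: y; apply: nbhs_right_lt; exact: iop_gt0.
by rewrite derive1E (@derive_val _ _ _ _ _ _ _ (der _ y0)) -(gh A) gle// (iop_gt0 hP).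
Unshelve. all: by end_near. Qed.

Lemma legendre_realizes (R : realType) (h : R -> R) :
  increasing_onto_pos h -> h 0 = 1 ->
  exists phi, [/\ transformation phi, essentially_smooth phi &
                  conjugate' phi =1 h].
Proof.
move=> hP h0.
have hh : {homo h : x y / x <= y} by move=> x y xy; rewrite (iop_mono hP).
have [Psi Psi0 sub] := monotone_antiderivative (iop_continuous hP) hh.
exists (legendre Psi); split.
- exact: (transformation_legendre hP sub).
- exact: (essentially_smooth_legendre hP sub).
- apply: conjugate_subgradient => // [t|t u _].
  + by rewrite (legendreE _ sub).
  + exact: legendre_subgradient.
Qed.

(** * Construction of [h] from a given response function *)

(* For [w = y + y / (1 + y)], [ell w = y] and [q y = rho w], the response equation
   and [rho w = gamma * h (w - y)] force [h (- y) = (1 - q y) / (1 - gamma)] and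
   [h (y / (1 + y)) = q y / gamma]; beyond 1 the choice is arbitrary. *)
Definition response_slope (R : realType) (gamma : R) (q : R -> R) (s : R) : R :=
  if s <= 0 then (1 - q (- s)) / (1 - gamma)
  else if s < 1 then q (s / (1 - s)) / gamma else gamma^-1 + (s - 1).

(** A limit-free form of (i)-(iv) for a response function completed by the value [gamma] at 0: an
    increasing bijection from [0, +oo[ onto [gamma, 1[. *)
Record increasing_onto_co (R : realType) (gamma : R) (q : R -> R) : Prop := {
  ioc0 : q 0 = gamma ;
  ioc_homo : forall x y, 0 <= x -> x < y -> q x < q y ;
  ioc_lt1 : forall x, q x < 1 ;
  ioc_onto : forall v, gamma <= v < 1 -> exists2 x, 0 <= x & q x = v }.

Lemma ltr_div_1B (R : realType) (s t : R) : s < t -> t < 1 ->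
  s / (1 - s) < t / (1 - t).
Proof.
move=> st t1; rewrite ltr_pdivrMr ?subr_gt0; last exact: lt_trans t1.
rewrite mulrAC ltr_pdivlMr ?subr_gt0//; lra.
Qed.

Lemma div_1BK (R : realType) (y : R) : 0 <= y ->
  y / (1 + y) / (1 - y / (1 + y)) = y.
Proof. by move=> y0; field; apply/andP; split; apply/eqP; lra. Qed.

(** The three branches increase and have the adjacent ranges ]0, 1], ]1, 1 / gamma[ and [1 / gamma,
    +oo[. *)
Lemma response_slope_increasing_onto (R : realType) (gamma : R) (q : R -> R) :
  0 < gamma < 1 -> increasing_onto_co gamma q ->
  increasing_onto_pos (response_slope gamma q).
Proof.
move=> /andP[g0 g1] [q0 qh q1 qo].
have g1' : 0 < 1 - gamma by rewrite subr_gt0.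
have qge y : 0 <= y -> gamma <= q y.
  by rewrite le_eqVlt => /predU1P[<-|y0]; [rewrite q0|rewrite -q0 ltW// qh].
have qgt y : 0 < y -> gamma < q y by move=> y0; rewrite -q0 qh.
have neg s : s <= 0 -> response_slope gamma q s <= 1.
  move=> s0; rewrite /response_slope s0 ler_pdivrMr// mul1r.
  by have := qge (- s); rewrite oppr_ge0 => /(_ s0); lra.
have mid s : 0 < s -> s < 1 -> 1 < response_slope gamma q s /\ response_slope gamma q s < gamma^-1.
  move=> s0 s1; rewrite /response_slope leNgt s0 s1 /=; split.
    by rewrite ltr_pdivlMr// mul1r qgt// divr_gt0// subr_gt0.
  by rewrite -[ltRHS]mul1r ltr_pM2r ?invr_gt0.
have g1V : 1 < gamma^-1 by rewrite invf_gt1.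
split.
- move=> x y xy.
  have [y0|y0] := leP y 0.
    have x0 : x <= 0 by exact/ltW/(lt_le_trans xy).
    rewrite /response_slope x0 y0 ltr_pM2r ?invr_gt0// ltrD2l ltrN2 qh//; lra.
  have [x0|x0] := leP x 0.
    apply: le_lt_trans (neg _ x0) _; have [y1|y1] := ltP y 1.
      by have [] := mid _ y0 y1.
    by rewrite /response_slope (leNgt y) y0 (ltNge y 1) y1 /=; lra.
  have [y1|y1] := ltP y 1.
    have x1 := lt_trans xy y1.
    rewrite /response_slope !leNgt x0 y0 x1 y1 /= ltr_pM2r ?invr_gt0// qh//.
      by rewrite divr_ge0//; lra.
    exact: ltr_div_1B.
  have [x1|x1] := ltP x 1.
    apply: lt_le_trans (proj2 (mid _ x0 x1)) _.
    by rewrite /response_slope (leNgt y) y0 (ltNge y 1) y1 /=; lra.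
  by rewrite /response_slope !leNgt x0 y0 (ltNge x 1) (ltNge y 1) x1 y1 /=; lra.
- move=> t; rewrite /response_slope; case: (leP t 0) => t0.
    by rewrite divr_gt0// subr_gt0.
  case: (ltP t 1) => t1; last by have := g1V; lra.
  by rewrite divr_gt0// (lt_trans g0)// qgt// divr_gt0// subr_gt0.
- move=> u u0; have [u1|u1] := leP u 1.
    have [|y y0 qy] := qo (1 - (1 - gamma) * u).
      have : (1 - gamma) * u <= 1 - gamma by rewrite ler_piMr// ltW.
      by have := mulr_gt0 g1' u0; lra.
    exists (- y); rewrite /response_slope oppr_le0 y0 opprK qy.
    by field; rewrite gt_eqF.
  have [u2|u2] := ltP u gamma^-1; last first.
    exists (1 + (u - gamma^-1)); rewrite /response_slope leNgt (ltNge _ 1).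
    have -> : 0 < 1 + (u - gamma^-1) by lra.
    have -> : 1 <= 1 + (u - gamma^-1) by lra.
    by rewrite /=; ring.
  have [|y y0 qy] := qo (gamma * u).
    rewrite mulrC -ltr_pdivlMr// mul1r u2 andbT.
    by rewrite mulrC ler_pMr// ltW.
  (* Strict positivity, due to [u > 1], places [y / (1 + y)] in the middle branch. *)
  have {y0} : 0 < y.
    rewrite lt_neqAle y0 andbT; apply/eqP => y0'.
    by move: qy; rewrite -y0' q0 => e; have : gamma * 1 < gamma * u; [rewrite ltr_pM2l|lra].
  move=> y0; exists (y / (1 + y)); rewrite /response_slope leNgt.
  have y1 : 0 < 1 + y by lra.
  rewrite divr_gt0//= ltr_pdivrMr// mul1r ltrDr ltr01 div_1BK ?ltW// qy.
  by field; rewrite gt_eqF.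
Qed.

Lemma response_extension (R : realType) (gamma : R) (rho : R -> R) :
  0 < gamma < 1 -> (forall w, 0 < w -> 0 < rho w < 1) ->
  response_properties gamma rho ->
  increasing_onto_co gamma (fun w => if 0 < w then rho w else gamma).
Proof.
move=> /andP[g0 g1] rho01 [rinc rcont rcvg0 rcvgy].
have {}rinc x y : 0 < x -> x < y -> rho x < rho y.
  by move=> x0 xy; apply: rinc; rewrite // in_itv/= andbT// (lt_trans x0).
have rgt w : 0 < w -> gamma < rho w.
  (* The limit at 0 gives only a weak inequality; applying it at [w / 2] and then increasing to [w]
     makes it strict. *)
  move=> w0; have w2 : 0 < w / 2 by lra.
  apply: (@le_lt_trans _ _ (rho (w / 2))); last by apply: rinc; lra.
  apply: (cvgr_to_le rcvg0); near=> x.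
  by apply/ltW/rinc; near: x; [exact: nbhs_right_gt|exact: nbhs_right_lt].
split.
- by rewrite ltxx.
- move=> x y x0 xy; rewrite (le_lt_trans x0 xy).
  by case: (ltP 0 x) => x0'; [exact: rinc|apply/rgt/(le_lt_trans x0)].
- by move=> x; case: (ltP 0 x) => // /rho01/andP[].
- move=> v /andP[]; rewrite le_eqVlt => /predU1P[<- _|gv v1].
    by exists 0 => //; rewrite ltxx.
  have [a a0 av] : exists2 a, 0 < a & rho a < v.
    near (0 : R)^'+ => a; exists a; first by near: a; exact: nbhs_right_gt.
    by near: a; exact: (cvgr_lt _ rcvg0 _ gv).
  have [b ab vb] : exists2 b, a < b & v < rho b.
    near +oo_R => b; exists b.
      by near: b; apply: nbhs_pinfty_gt; exact: num_real.
    by near: b; exact: (cvgr_gt _ rcvgy _ v1).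
  have [|||x xab xv] := @IVT _ rho a b v; first exact: ltW.
  + apply: continuous_subspaceW rcont => x /=; rewrite !in_itv/= andbT.
    by move=> /andP[ax _]; exact: lt_le_trans ax.
  + by rewrite ge_min le_max (ltW av) (ltW vb) orbT.
  + have x0 : 0 < x by move: xab; rewrite in_itv/= => /andP[ax _]; lra.
    by exists x; [exact: ltW|rewrite x0].
Unshelve. all: by end_near. Qed.

Lemma reparam_onto (R : realType) (w : R) : 0 <= w ->
  exists2 y, 0 <= y & y + y / (1 + y) = w.
Proof.
move=> w0.
(* Clearing the denominator gives [y ^+ 2 + (2 - w) * y - w = 0], of discriminant [w ^+ 2 + 4]; the
   witness is its larger root, nonnegative because [2 - w <= s]. *)
have [s s0 s2] : exists2 s, 0 <= s & s ^+ 2 = w ^+ 2 + 4.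
  exists (Num.sqrt (w ^+ 2 + 4)); first exact: sqrtr_ge0.
  by rewrite sqr_sqrtr// addr_ge0// sqr_ge0.
have ws : 2 - w <= s.
  rewrite leNgt; apply/negP => sw.
  have : 0 < (2 - w - s) * (2 - w + s) by rewrite mulr_gt0; lra.
  by rewrite !expr2 in s2; lra.
have y1 : 1 + (w - 2 + s) / 2 != 0 by apply/eqP; lra.
exists ((w - 2 + s) / 2); first lra.
apply: (mulIf y1); rewrite mulrDl divfK//.
apply/eqP; rewrite -subr_eq0; apply/eqP.
transitivity ((s ^+ 2 - (w ^+ 2 + 4)) / 4); first by field.
by rewrite s2 subrr mul0r.
Qed.

Lemma increasing_onto_co_reparam (R : realType) (gamma : R) (r : R -> R) :
  increasing_onto_co gamma r ->
  increasing_onto_co gamma (fun y => r (y + y / (1 + y))).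
Proof.
move=> [r0 rh r1 ro]; split => //.
- by rewrite mul0r addr0.
- move=> x y x0 xy; have y0 := le_lt_trans x0 xy; apply: rh.
    by rewrite addr_ge0// divr_ge0//; lra.
  apply: ltrD => //; rewrite ltr_pdivrMr; last lra.
  by rewrite mulrAC ltr_pdivlMr; lra.
- by move=> v /ro[w /reparam_onto[y y0 <-] <-]; exists y.
Qed.

Lemma response_realizable (R : realType) (gamma : R) (rho : R -> R) :
  0 < gamma < 1 -> (forall w, 0 < w -> 0 < rho w < 1) ->
  response_properties gamma rho ->
  exists phi : R -> \bar R,
    [/\ transformation phi, essentially_smooth phi &
        forall w, 0 < w -> rho w = response gamma phi w].
Proof.
move=> g01 rho01 rhoP; have /andP[g0 g1] := g01.
have rP := response_extension g01 rho01 rhoP.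
set r := (fun w => _) in rP.
have qP := increasing_onto_co_reparam rP.
set q := (fun y => _) in qP.
have hP := response_slope_increasing_onto g01 qP; set h := response_slope gamma q in hP.
have h0 : h 0 = 1.
  by rewrite /h /response_slope lexx oppr0 (ioc0 qP) divff// gt_eqF// subr_gt0.
have [phi [tphi sphi phiE]] := legendre_realizes hP h0.
exists phi; split => // w w0.
have [y y0 wE] := reparam_onto (ltW w0).
have {}y0 : 0 < y.
  by rewrite lt_neqAle y0 andbT; apply/eqP => e; move: wE w0; rewrite -e; lra.
have y1 : 0 < 1 + y by lra.
(* By the choice of [y], [w - y] is [y / (1 + y)], strictly between 0 and 1. *)
have hl : h (w - y) = rho w / gamma.
  rewrite -{1}wE addrC addKr /h /response_slope leNgt divr_gt0//= ltr_pdivrMr//.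
  by rewrite mul1r ltrDr ltr01 div_1BK ?ltW// /q wE /r w0.
have hr : h (- y) = (1 - rho w) / (1 - gamma).
  by rewrite /h /response_slope oppr_le0 ltW// opprK /q wE /r w0.
(* With these two values of [h] the response equation at [l = y] reads [rho w + (1 - rho w) = 1], so
   [ell] is [y] and the response is [gamma * (rho w / gamma)]. *)
rewrite /response (@response_equation_ellP _ _ _ y _ h)// ?phiE ?hl ?hr.
  by field; rewrite gt_eqF.
by field; rewrite !gt_eqF// subr_gt0.
Qed.

Theorem proposition6 (R : realType) :
  (forall (gamma : R) (phi : R -> \bar R), 0 < gamma < 1 ->
     transformation phi -> essentially_smooth phi ->
     (forall w : R, 0 < w -> 0 < response gamma phi w < 1) /\
     response_properties gamma (response gamma phi)) /\
  (forall (gamma : R) (rho : R -> R), 0 < gamma < 1 ->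
     (forall w : R, 0 < w -> 0 < rho w < 1) ->
     response_properties gamma rho ->
     exists phi : R -> \bar R,
       [/\ transformation phi, essentially_smooth phi &
           forall w : R, 0 < w -> rho w = response gamma phi w]).
Proof.
split=> [gamma phi g01 tphi sphi|gamma rho]; last exact: response_realizable.
have [h hP phiE] := conjugate'_essentially_smooth tphi sphi.
exact: response_of_inverse hP phiE.
Qed.
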